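(* Let $n,k$ be positive integers, and let $m_1+\cdots+m_k=n$ and $m_1'+\cdots+m_k'=n$ be any two partitions of $n$ into $k$ positive integer parts. Then the graphs $IS(m_1,\ldots,m_k)$ and $IS(m_1',\ldots,m_k')$ are cospectral with respect to the normalized Laplacian. That is, the spectrum of the normalized Laplacian of $IS(m_1,\ldots,m_k)$ is completely determined by $n$ and $k$.
   Context: All graphs are finite, simple and undirected. For positive integers $m_1,\ldots,m_k$ with $m_1+\cdots+m_k=n$, the ''inflated star'' graph $IS(m_1,\ldots,m_k)$ is the graph on the $n+k+1$ vertices $a,b_1,\ldots,b_n,v_1,\ldots,v_k$ in which $a$ and the $b_i$ induce a star graph with $a$ as the central vertex, each $v_i$ is adjacent to exactly $m_i$ vertices from $b_1,\ldots,b_n$ and to no other vertices, and each $b_i$ is adjacent to exactly one of $v_1,\ldots,v_k$. (This determines the graph up to isomorphism.) The normalized Laplacian of a graph is $\mathcal{L}=D^{-1/2}(D-\mathrm{Adj})D^{-1/2}$, where $\mathrm{Adj}$ is the adjacency matrix and $D$ is the diagonal matrix of degrees. Two graphs are cospectral with respect to a matrix if the associated matrices have the same eigenvalues with the same multiplicities. *)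

(* Defs.v *)
From HB Require Import structures.
From mathcomp Require Import all_boot all_order all_algebra.

Set Implicit Arguments.
Unset Strict Implicit.
Unset Printing Implicit Defensive.

Import Order.TTheory GRing.Theory Num.Theory.
Local Open Scope ring_scope.

Record sgraph := SGraph {
  vertex :> finType;
  adj : rel vertex;
  adj_sym : symmetric adj;
  adj_irr : irreflexive adj }.

Definition degree (G : sgraph) (x : G) : nat := #|[set y : G | adj x y]|.

(* Rows and columns of the matrices of a graph are indexed by its vertices
   through the enumeration enum_val. *)
Definition adj_mx (R : rcfType) (G : sgraph) : 'M[R]_#|G| :=
  \matrix_(i, j) (adj (enum_val i : G) (enum_val j : G))%:R.

Definition degree_mx (R : rcfType) (G : sgraph) : 'M[R]_#|G| :=
  diag_mx (\row_i (degree (enum_val i : G))%:R).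

(* D^{-1/2}; an isolated vertex gets the entry 0, since 0^-1 = 0. *)
Definition degree_isqrt_mx (R : rcfType) (G : sgraph) : 'M[R]_#|G| :=
  diag_mx (\row_i (Num.sqrt ((degree (enum_val i : G))%:R : R))^-1).

Definition normalized_laplacian (R : rcfType) (G : sgraph) : 'M[R]_#|G| :=
  degree_isqrt_mx R G *m (degree_mx R G - adj_mx R G) *m degree_isqrt_mx R G.

(* Algebraic multiplicity; it is 0 exactly when x is not an eigenvalue. *)
Definition eigen_mult (F : fieldType) (p : nat) (A : 'M[F]_p) (x : F) : nat :=
  mup x (char_poly A).

(* Only eigenvalues in R are compared. This loses nothing for symmetric
   matrices over a real closed field, whose eigenvalues all lie in R. *)
Definition cospectral_mx (R : rcfType) (p q : nat)
    (A : 'M[R]_p) (B : 'M[R]_q) : Prop :=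
  forall x : R, eigen_mult A x = eigen_mult B x.

Definition star_label (T : Type) (n k : nat) (a : T) (b : 'I_n -> T)
    (v : 'I_k -> T) (x : option ('I_n + 'I_k)) : T :=
  match x with
  | None => a
  | Some (inl i) => b i
  | Some (inr i) => v i
  end.

(* G is (isomorphic to) IS(m_1, ..., m_k): bijectivity of star_label says that
   the vertices of G are a, b_1, ..., b_n, v_1, ..., v_k without repetition. *)
Definition inflated_star (n k : nat) (m : 'I_k -> nat) (G : sgraph) : Prop :=
  exists (a : G) (b : 'I_n -> G) (v : 'I_k -> G),
    bijective (star_label a b v) /\
    [/\ forall j, adj a (b j) /\ forall j', ~~ adj (b j) (b j'),
        forall i, #|[set j | adj (v i) (b j)]| = m i,
        forall i, ~~ adj (v i) a /\ forall i', ~~ adj (v i) (v i')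
      & forall j, #|[set i | adj (b j) (v i)]| = 1%N].

Section Existence.
Variables (n k : nat) (m : 'I_k -> nat).

Definition is_adj (f : 'I_n -> 'I_k) (x y : option ('I_n + 'I_k)) : bool :=
  match x, y with
  | None, Some (inl _) | Some (inl _), None => true
  | Some (inl j), Some (inr i) | Some (inr i), Some (inl j) => f j == i
  | _, _ => false
  end.

Lemma is_adj_sym f : symmetric (is_adj f).
Proof. by case=> [[?|?]|] [[?|?]|]. Qed.

Lemma is_adj_irr f : irreflexive (is_adj f).
Proof. by case=> [[?|?]|]. Qed.

Lemma inflated_star_exists :
  (\sum_(i < k) m i)%N = n -> exists G, inflated_star n m G.
Proof.
move=> sum_m; pose B := {i : 'I_k & 'I_(m i)}.
have cardB : #|{: B}| = n.
  rewrite card_tagged sumnE big_map big_enum /= -sum_m.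
  by apply: eq_bigr => i _; rewrite card_ord.
pose g (j : 'I_n) : B := enum_val (cast_ord (esym cardB) j).
have g_bij : bijective g.
  exists (fun x : B => cast_ord cardB (enum_rank x)) => x.
    by rewrite /g enum_valK cast_ordKV.
  by rewrite /g cast_ordK enum_rankK.
pose f j := tag (g j).
exists (SGraph (is_adj_sym f) (is_adj_irr f)).
exists None, (fun j => Some (inl j)), (fun i => Some (inr i)); split.
  by exists id => [[[?|?]|]|[[?|?]|]].
split=> //= [i | j].
  rewrite -(card_imset _ (bij_inj g_bij)) -[RHS]card_ord.
  have tinj : injective (@Tagged _ i (fun i => 'I_(m i))).
    by move=> u w /eqP; rewrite eq_Tagged => /eqP.
  rewrite -(card_codom tinj); apply: eq_card => x.
  apply/imsetP/codomP => [[j] | [u ->]].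
    rewrite inE /f => /eqP <- ->; exists (tagged (g j)).
    by rewrite /Tagged; case: (g j).
  case: (g_bij) => h _ hK; exists (h (Tagged (fun i => 'I_(m i)) u)); last by rewrite hK.
  by rewrite inE /f hK.
by rewrite -(cards1 (f j)); apply: eq_card => i; rewrite !inE eq_sym.
Qed.
End Existence.

(* Main.v *)
Require Import Defs.
From mathcomp Require Import all_boot all_order all_algebra.
From mathcomp Require Import perm ring.

(** An inflated star is bipartite with parts [{a, v_1, .., v_k}] and
    [{b_1, .., b_n}], so its normalized adjacency matrix is [[0, B], [B^T, 0]]
    and, with [y := 'X - 1], the characteristic polynomial of its normalized
    Laplacian is [det (y^2 - B B^T)] up to powers of [y].  Every diagonal entry
    of [B B^T] is [1/2], and the only other nonzero entries are the
    [sqrt (m_i / n) / 2] in the row and the column of [a]; the squares of these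
    sum to [1/4] over [i], so a second block elimination makes the [m_i]
    disappear. *)

Set Implicit Arguments.
Unset Strict Implicit.
Unset Printing Implicit Defensive.

Import Order.TTheory GRing.Theory Num.Theory.
Local Open Scope ring_scope.

(** * Determinants of reindexed and block matrices *)

Lemma det_reindex (R : comNzRingType) (T : Type) (p q : nat)
    (g : 'I_p -> T) (h : 'I_q -> T) (F : T -> T -> R) :
  bijective g -> bijective h ->
  \det (\matrix_(i, j) F (g i) (g j)) = \det (\matrix_(i, j) F (h i) (h j)).
Proof.
move=> [g' gK g'K] h_bij; case: (h_bij) => h' hK h'K.
have g'h_inj : injective (g' \o h).
  exact: inj_comp (can_inj g'K) (bij_inj h_bij).
have h'g_inj : injective (h' \o g) by exact: inj_comp (can_inj h'K) (can_inj gK).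
have eq_pq : p = q.
  apply/eqP; rewrite eqn_leq.
  by have:= leq_card _ g'h_inj; have:= leq_card _ h'g_inj; rewrite !card_ord => -> ->.
subst q; pose s := perm g'h_inj.
(* Permuting rows and columns by the same [s] contributes the sign of [s] twice, so the signs
   cancel. *)
rewrite -[RHS](_ : \det (row_perm s (col_perm s (\matrix_(i, j) F (g i) (g j)))) = _).
  rewrite row_permE col_permE !det_mulmx !det_perm odd_permV mulrCA.
  by rewrite -signr_addb addbb mulr1.
by congr (\det _); apply/matrixP=> i j; rewrite !mxE !permE /= !g'K.
Qed.

(** Schur complement without division by [y]: multiplying on the left by the block matrix with rows
    [(y, -B)] and [(0, 1)], of determinant [y ^+ p], clears the upper right block. *)
Lemma det_block_scalar (R : comNzRingType) (p q : nat) (y : R)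
    (B : 'M[R]_(p, q)) (C : 'M[R]_(q, p)) :
  y ^+ p * \det (block_mx y%:M B C y%:M)
    = \det ((y ^+ 2)%:M - B *m C) * y ^+ q.
Proof.
have <- : \det (block_mx y%:M (- B) 0 1%:M) = y ^+ p.
  by rewrite det_ublock det1 mulr1 det_scalar.
rewrite -det_mulmx mulmx_block !mul0mx !mul1mx !add0r mulNmx -scalar_mxM -expr2.
by rewrite mul_scalar_mx mulNmx mul_mx_scalar subrr det_lblock det_scalar.
Qed.

(** After one elimination, the matrix [y ^+ 2 - B *m B^T] again has scalar diagonal blocks, both
    equal to [z]. A second elimination therefore applies; its Schur complement has size 1, and the
    leading factor [z] is its price. *)
Lemma det_two_row_block (R : comNzRingType) (k n : nat) (y c d : R)
    (P : 'M[R]_(1, n)) (Q : 'M[R]_(k, n)) :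
  P *m P^T = c%:M -> Q *m Q^T = c%:M -> (P *m Q^T) *m (Q *m P^T) = d%:M ->
  let B : 'M_(1 + k, n) := col_mx P Q in
  let z := y ^+ 2 - c in
  z * (y ^+ (1 + k) * \det (block_mx y%:M B B^T y%:M))
    = (z ^+ 2 - d) * z ^+ k * y ^+ n.
Proof.
move=> PP QQ PQQP B z; rewrite det_block_scalar mulrA; congr (_ * _).
rewrite tr_col_mx mul_col_row PP QQ scalar_mx_block opp_block_mx add_block_mx.
rewrite !add0r -!raddfB /= -/z -{1}(expr1 z) det_block_scalar.
by rewrite mulNmx mulmxN opprK PQQP -raddfB /= det_scalar1.
Qed.

(** * Characteristic polynomial of a normalized Laplacian *)

Lemma normalized_laplacianE (R : rcfType) (G : sgraph) :
  (forall x : G, 0 < degree x)%N ->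
  normalized_laplacian R G
    = \matrix_(i, j)
        ((enum_val i == enum_val j)%:R
         - (adj (enum_val i : G) (enum_val j : G))%:R
           / Num.sqrt (degree (enum_val i : G))%:R
           / Num.sqrt (degree (enum_val j : G))%:R).
Proof.
move=> deg_gt0; apply/matrixP=> i j.
rewrite /normalized_laplacian mul_mx_diag mul_diag_mx !mxE.
rewrite (inj_eq enum_val_inj) mulrBr mulrBl; congr (_ - _); last by ring.
case: (eqVneq i j) => [<-|_]; last by rewrite mulr0 mul0r.
rewrite mulr1n -[X in _ * X / _](sqr_sqrtr (ler0n _ _)).
(* Positive degree makes the diagonal entry [1]; at an isolated vertex it would be [0]. *)
have s_neq0 : Num.sqrt (degree (enum_val i : G))%:R != 0 :> R.
  by rewrite gt_eqF // sqrtr_gt0 ltr0n.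
by rewrite expr2 mulKf // mulfV.
Qed.

Lemma char_poly_normalized_laplacian (R : rcfType) (G : sgraph) (p : nat)
    (h : 'I_p -> G) :
  bijective h -> (forall x : G, 0 < degree x)%N ->
  char_poly (normalized_laplacian R G)
    = \det (('X - 1)%:M
        + \matrix_(i, j) ((adj (h i) (h j))%:R
             / Num.sqrt (degree (h i))%:R / Num.sqrt (degree (h j))%:R)%:P).
Proof.
move=> h_bij deg_gt0.
(* Entries are written as a function of two vertices, so that [det_reindex] can replace [enum_val]
   by [h]. The unit diagonal of the Laplacian turns ['X] into ['X - 1]. *)
pose F (x y : G) : {poly R} := ('X - 1) *+ (x == y)
   + ((adj x y)%:R / Num.sqrt (degree x)%:R / Num.sqrt (degree y)%:R)%:P.
have /= := det_reindex F (@enum_val_bij G) h_bij.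
rewrite /char_poly => detF.
transitivity (\det (\matrix_(i < #|G|, j < #|G|) F (enum_val i) (enum_val j))).
  congr (\det _); apply/matrixP=> i j.
  rewrite /char_poly_mx normalized_laplacianE // !mxE /F (inj_eq enum_val_inj).
  by rewrite rmorphB /= opprB addrA addrAC; case: (i == j); rewrite ?subr0.
rewrite detF; congr (\det _); apply/matrixP=> i j.
by rewrite !mxE /F (inj_eq (bij_inj h_bij)).
Qed.

(** The order [a], [v_1, .., v_k], [b_1, .., b_n] puts each side of the bipartition in one block and
    isolates the row of [a]. *)
Definition star_index (n k : nat) (i : 'I_((1 + k) + n)) : option ('I_n + 'I_k) :=
  match split i with
  | inl i' => match split i' with inl _ => None | inr t => Some (inr t) end
  | inr j => Some (inl j)
  end.

Lemma star_index_bij (n k : nat) : bijective (@star_index n k).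
Proof.
exists (fun x => match x with
  | None => lshift n (lshift k ord0)
  | Some (inr t) => lshift n (rshift 1 t)
  | Some (inl j) => rshift (1 + k) j end).
  move=> i; rewrite /star_index; case: split_ordP => [i' ->|j ->] //.
  by case: split_ordP => [o ->|t ->] //; rewrite [o]ord1.
by case=> [[j|t]|]; rewrite /star_index ?(unsplitK (inl _)) ?(unsplitK (inr _)).
Qed.

(** * Degrees and biadjacency blocks of an inflated star *)

Section InflatedStar.
Variables (R : rcfType) (n k : nat) (m : 'I_k -> nat) (G : sgraph).
Variables (a : G) (b : 'I_n -> G) (v : 'I_k -> G).
Hypotheses (n_gt0 : (0 < n)%N) (m_gt0 : forall i, (0 < m i)%N).
Hypothesis sum_m : (\sum_(i < k) m i)%N = n.
Hypothesis label_bij : bijective (star_label a b v).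
Hypothesis adj_ab : forall j, adj a (b j).
Hypothesis adj_bb : forall j j', adj (b j) (b j') = false.
Hypothesis adj_va : forall i, adj (v i) a = false.
Hypothesis adj_vv : forall i i', adj (v i) (v i') = false.
Hypothesis card_vb : forall i, #|[set j | adj (v i) (b j)]| = m i.
Hypothesis card_bv : forall j, #|[set i | adj (b j) (v i)]| = 1%N.

Let h := star_label a b v \o @star_index n k.

Let h_bij : bijective h.
Proof. exact: bij_comp label_bij (star_index_bij n k). Qed.

Let h_a (o : 'I_1) : h (lshift n (lshift k o)) = a.
Proof. by rewrite /h /= /star_index !(unsplitK (inl _)). Qed.

Let h_v i : h (lshift n (rshift 1 i)) = v i.
Proof. by rewrite /h /= /star_index (unsplitK (inl _)) (unsplitK (inr _)). Qed.

Let h_b j : h (rshift (1 + k) j) = b j.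
Proof. by rewrite /h /= /star_index (unsplitK (inr _)). Qed.

Let degreeE (x : G) :
  degree x = (adj x a + \sum_(i < k) adj x (v i) + \sum_(j < n) adj x (b j))%N.
Proof.
rewrite /degree -sum1dep_card big_mkcond /= (reindex h) /=; last exact: onW_bij.
rewrite big_split_ord big_split_ord big_ord1 /=.
rewrite h_a; congr (_ + _ + _)%N.
  by apply: eq_bigr => i _; rewrite h_v; case: (adj x (v i)).
by apply: eq_bigr => i _; rewrite h_b; case: (adj x (b i)).
Qed.

Let sum_card (T : finType) (A : pred T) : (\sum_i A i)%N = #|[set i | A i]|.
Proof. by rewrite -sum1dep_card [RHS]big_mkcond; apply: eq_bigr => i _; case: (A i). Qed.

Let degree_a : degree a = n.
Proof.
rewrite degreeE adj_irr big1 => [|i _]; last by rewrite adj_sym adj_va.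
by under eq_bigr do rewrite adj_ab; rewrite sum1_card card_ord.
Qed.

Let degree_b j : degree (b j) = 2%N.
Proof.
rewrite degreeE adj_sym adj_ab sum_card card_bv big1 // => i _.
by rewrite adj_bb.
Qed.

Let degree_v i : degree (v i) = m i.
Proof.
rewrite degreeE adj_va big1 => [|i' _]; last by rewrite adj_vv.
by rewrite sum_card card_vb.
Qed.

Let degree_gt0 (x : G) : (0 < degree x)%N.
Proof.
case: label_bij => l _ lK; rewrite -(lK x); case: (l x) => [[j|i]|] /=.
- by rewrite degree_b.
- by rewrite degree_v.
- by rewrite degree_a.
Qed.

Let s (d : nat) : R := Num.sqrt d%:R.
Let s_sqr d : s d * s d = d%:R.
Proof. by rewrite -expr2 sqr_sqrtr ?ler0n. Qed.
Let s_neq0 d : (0 < d)%N -> s d != 0.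
Proof. by move=> d_gt0; rewrite gt_eqF // sqrtr_gt0 ltr0n. Qed.

(** The normalized biadjacency matrix against the [b_j]: [P] is the row of [a], of degree [n], and
    [Q] has the rows of the [v_i], of degree [m i]. The factor [s 2] comes from the degree of
    [b_j]. *)
Let P : 'M[R]_(1, n) := \matrix_(o, j) (s n * s 2)^-1.
Let Q : 'M[R]_(k, n) := \matrix_(i, j) ((adj (v i) (b j))%:R / (s (m i) * s 2)).

Let PPt : P *m P^T = (2^-1)%:M.
Proof.
apply/matrixP=> o o'; rewrite !mxE [o]ord1 [o']ord1 eqxx mulr1n.
under eq_bigr do rewrite !mxE.
rewrite sumr_const card_ord -[LHS]mulr_natl -invfM mulrACA !s_sqr.
by rewrite invfM mulrA mulfV ?mul1r // pnatr_eq0 -lt0n.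
Qed.

Let adj_v_uniq i i' j : adj (v i) (b j) -> adj (v i') (b j) -> i = i'.
Proof.
move/eqP: (card_bv j) => /cards1P [t def_t] vi vi'.
have: i \in [set i | adj (b j) (v i)] by rewrite inE adj_sym.
have: i' \in [set i | adj (b j) (v i)] by rewrite inE adj_sym.
by rewrite def_t !inE => /eqP -> /eqP ->.
Qed.

Let sum_vb i : \sum_j (adj (v i) (b j))%:R = (m i)%:R :> R.
Proof. by rewrite -natr_sum sum_card card_vb. Qed.

(** Distinct rows have disjoint supports, since each [b_j] has a single neighbour among the [v_i];
    row [i] has [m i] nonzero entries, each of square [1 / (2 m_i)]. *)
Let QQt : Q *m Q^T = (2^-1)%:M.
Proof.
apply/matrixP=> i i'; rewrite !mxE.
case: (eqVneq i i') => [<-|ne_ii']; last first.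
  rewrite big1 // => j _; rewrite !mxE.
  case: (boolP (adj (v i) (b j))) => [vi|_]; last by rewrite mul0r mul0r.
  case: (boolP (adj (v i') (b j))) => [vi'|_]; last by rewrite !(mul0r, mulr0).
  by rewrite (adj_v_uniq vi vi') eqxx in ne_ii'.
have -> : \sum_j Q i j * Q^T j i
    = \sum_j (adj (v i) (b j))%:R * (s (m i) * s 2 * (s (m i) * s 2))^-1.
  apply: eq_bigr => j _; rewrite !mxE mulrACA -invfM -natrM mulnb andbb.
  by [].
rewrite -mulr_suml sum_vb mulrACA !s_sqr invfM mulrA mulfV ?mul1r ?mulr1n //.
by rewrite pnatr_eq0 -lt0n.
Qed.

Let PQt o i : (P *m Q^T) o i = s (m i) / (s n * 2).
Proof.
rewrite mxE.
have -> : \sum_j P o j * Q^T j i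
    = \sum_j (adj (v i) (b j))%:R * ((s n * s 2)^-1 / (s (m i) * s 2)).
  by apply: eq_bigr => j _; rewrite !mxE mulrCA.
(* Writing [m i] as the square of [s (m i)] lets one root cancel with the denominator. *)
rewrite -mulr_suml sum_vb -s_sqr -invfM mulrACA (s_sqr 2) [s n * s _]mulrC.
by rewrite -[_ * s n * _]mulrA invfM mulrA mulfK ?s_neq0.
Qed.

(** The squares [m_i / (4 n)] add up to [1/4] because the [m_i] sum to [n]. *)
Let PQQP : (P *m Q^T) *m (Q *m P^T) = (4^-1)%:M.
Proof.
have -> : Q *m P^T = (P *m Q^T)^T by rewrite trmx_mul trmxK.
apply/matrixP=> o o'; rewrite mxE [o]ord1 [o']ord1 mxE eqxx mulr1n.
have -> : \sum_j (P *m Q^T) ord0 j * (P *m Q^T)^T j ord0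
    = \sum_j (m j)%:R * (s n * 2 * (s n * 2))^-1.
  by apply: eq_bigr => i _; rewrite [X in _ * X]mxE !PQt mulrACA s_sqr -invfM.
rewrite -mulr_suml -natr_sum sum_m mulrACA s_sqr invfM mulrA mulfV ?mul1r.
  by rewrite -natrM.
by rewrite pnatr_eq0 -lt0n.
Qed.

Let char_poly_block :
  let B : 'M[{poly R}]_(1 + k, n) := col_mx (map_mx polyC P) (map_mx polyC Q) in
  char_poly (normalized_laplacian R G)
    = \det (block_mx ('X - 1)%:M B B^T ('X - 1)%:M).
Proof.
move=> B; rewrite (char_poly_normalized_laplacian _ h_bij) //.
congr (\det _); rewrite [X in X + _]scalar_mx_block.
(* Splitting the adjacency part into four blocks: the two diagonal ones vanish because there are no
   edges inside either side. *)
rewrite -[X in _ + X]submxK add_block_mx.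
congr block_mx.
- rewrite -[RHS]addr0; congr (_ + _); apply/matrixP=> i i'; rewrite !mxE.
  case: (split_ordP i) => [o ->|t ->]; case: (split_ordP i') => [o' ->|t' ->];
    rewrite ?h_a ?h_v ?adj_irr ?adj_va ?adj_vv ?mul0r //.
  by rewrite adj_sym adj_va !mul0r.
- rewrite add0r; apply/matrixP=> i j; rewrite !mxE h_b degree_b.
  case: (split_ordP i) => [o ->|t ->]; rewrite ?h_a ?h_v !mxE.
    by rewrite degree_a adj_ab mul1r invfM.
  by rewrite degree_v -mulrA -invfM.
- rewrite add0r; apply/matrixP=> j i; rewrite !mxE h_b degree_b.
  case: (split_ordP i) => [o ->|t ->]; rewrite ?h_a ?h_v !mxE.
    by rewrite degree_a adj_sym adj_ab mul1r invfM mulrC.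
  by rewrite degree_v adj_sym -mulrA -invfM [s 2 * _]mulrC.
- rewrite -[RHS]addr0; congr (_ + _); apply/matrixP=> j j'; rewrite !mxE.
  by rewrite !h_b adj_bb !mul0r.
Qed.

Lemma char_poly_inflated_star_label :
  let y : {poly R} := 'X - 1 in
  let z := y ^+ 2 - (2^-1)%:P in
  z * (y ^+ (1 + k) * char_poly (normalized_laplacian R G))
    = (z ^+ 2 - (4^-1)%:P) * z ^+ k * y ^+ n.
Proof.
move=> y z; rewrite char_poly_block; apply: det_two_row_block.
- by rewrite map_trmx -map_mxM PPt map_scalar_mx.
- by rewrite map_trmx -map_mxM QQt map_scalar_mx.
- by rewrite !map_trmx -!map_mxM PQQP map_scalar_mx.
Qed.

End InflatedStar.

(** The right-hand side involves only [n] and [k]. Its factor [z ^+ 2 - 1/4] equals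
    [y ^+ 2 * (y ^+ 2 - 1)], which accounts for the eigenvalues 0 and 2. *)
Lemma char_poly_inflated_star (R : rcfType) (n k : nat) (m : 'I_k -> nat)
    (G : sgraph) :
  (0 < n)%N -> (forall i, 0 < m i)%N -> (\sum_(i < k) m i)%N = n ->
  inflated_star n m G ->
  let y : {poly R} := 'X - 1 in
  let z := y ^+ 2 - (2^-1)%:P in
  z * (y ^+ (1 + k) * char_poly (normalized_laplacian R G))
    = (z ^+ 2 - (4^-1)%:P) * z ^+ k * y ^+ n.
Proof.
move=> n_gt0 m_gt0 sum_m [a [b [v [lab_bij [ab vb vv bv]]]]].
apply: (char_poly_inflated_star_label _ n_gt0 m_gt0 sum_m lab_bij) => //.
- by move=> j; case: (ab j).
- by move=> j j'; case: (ab j) => _ /(_ j') /negbTE.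
- by move=> i; case: (vv i) => /negbTE.
- by move=> i i'; case: (vv i) => _ /(_ i') /negbTE.
Qed.

Theorem mainTheorem7 (R : rcfType) (n k : nat) (m m' : 'I_k -> nat)
    (n_gt0 : (0 < n)%N) (k_gt0 : (0 < k)%N)
    (m_gt0 : forall i, (0 < m i)%N) (m'_gt0 : forall i, (0 < m' i)%N)
    (sum_m : (\sum_(i < k) m i)%N = n) (sum_m' : (\sum_(i < k) m' i)%N = n)
    (G G' : sgraph) (G_IS : inflated_star n m G) (G'_IS : inflated_star n m' G') :
  cospectral_mx (normalized_laplacian R G) (normalized_laplacian R G').
Proof.
move=> x; rewrite /eigen_mult; congr mup.
have /= := char_poly_inflated_star R n_gt0 m_gt0 sum_m G_IS.
rewrite -(char_poly_inflated_star R n_gt0 m'_gt0 sum_m' G'_IS) /=.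
(* Both characteristic polynomials now carry the same left factors, which cancel in the integral
   domain [{poly R}] once they are nonzero. *)
have y_neq0 : 'X - 1 != 0 :> {poly R} by rewrite -polyC1 polyXsubC_eq0.
have z_neq0 : ('X - 1) ^+ 2 - (2^-1)%:P != 0 :> {poly R}.
  (* The value at 1 is [- 2^-1], which is nonzero. *)
  apply: contraTneq isT => /(congr1 (fun p => p.[1])).
  rewrite !hornerE subrr expr0n add0r => /eqP.
  by rewrite oppr_eq0 invr_eq0 pnatr_eq0.
by move/(mulfI z_neq0)/(mulfI (expf_neq0 _ y_neq0)).
Qed.
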